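(* Let $q=p^h$ with $p$ prime, let $a,b\in\mathbb{F}_q$, and let $n$ be a prime number with $n\neq 2,3$. If $n^2\not\equiv ab \pmod p$ (that is, the element $n^2\cdot 1\in\mathbb{F}_q$ is different from $ab$), then there exists a monic irreducible polynomial of degree $n$ over $\mathbb{F}_q$ of the form $X^n+c_1X^{n-1}+c_2X^{n-2}+\cdots+c_{n-1}X+c_n$ with $c_1=a$ and $c_{n-1}/c_n=b$. *)

(* Defs.v *)
From mathcomp Require Export all_boot all_order all_algebra all_field.

Set Implicit Arguments.
Unset Strict Implicit.
Unset Printing Implicit Defensive.

(* Main.v *)
Require Import Defs.
From mathcomp Require Import all_boot all_order all_algebra all_fingroup all_field.
From mathcomp Require Import zify ring.
Import Order.TTheory GRing.Theory Num.Theory.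
Local Open Scope ring_scope.

(**
With q = |F|, A = -a, B = -b and L the extension of F of degree n, the wanted polynomial is the minimal polynomial
of some x in L \ F with Tr x = A and Tr (1/x) = B.  Elements of F have traces n x and n / x, whose product is n^2,
so ab <> n^2 makes any such x lie outside F, and x then has degree n because n is prime.  Existence of x is a
counting argument: expanding the two trace conditions in additive characters, q^2 times the number of solutions is
q^n - 1, plus 2 (q - 1) terms of absolute value 1, plus (q - 1)^2 Kloosterman sums over L, each at most 2 q^(n/2);
the total is nonzero for all q >= 2 as soon as n >= 5.

The Weil bound for Kloosterman sums is obtained in two steps.  The curve y^p - y = x + u/x + e is a double cover
x^2 - w x + u = 0 of the y-line, w = y^p - y - e, so that functions on it are pairs of polynomials in y, and Stepanov's
method (in Bombieri's form) bounds its number of points over a field with r^2 elements by r^2 + O(p r); hence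
Kloosterman sums over such fields are O(p r).  The relation K' = 2 q - K^2 between the sums over F_q and F_(q^2)
then turns a bound K^2 <= (4 + d) q, valid for all fields of characteristic p, into K^2 <= (4 + d/4) q.
*)

(** * Functions on the curve [x^2 - w x + t = 0] *)

Section Lucas.
Variables (E : fieldType) (p : nat) (t e : E).
Hypothesis p_gt1 : (1 < p)%N.

(* This is the trace w of x: on the curve y^p - y = x + t/x + e the conjugate of x over E(y) is w - x = t/x. *)
Definition artin_schreier : {poly E} := 'X^p - 'X - e%:P.
Local Notation w := artin_schreier.

Fixpoint lucas_pair (n : nat) : {poly E} * {poly E} :=
  if n is m.+1 then let: (b, b') := lucas_pair m in (b', w * b' - t *: b)
  else (0, 1).
(* x^n = lucas_shift n + lucas n * x and (t/x)^n = lucas n.+1 - lucas n * x *)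
Definition lucas n := (lucas_pair n).1.

(** The value 1 at 0 is what [- t * lucas (n - 1)] gives when the recurrence of [lucas] is run one
    step backwards, to index -1. *)
Definition lucas_shift (n : nat) : {poly E} := if n is m.+1 then - (t *: lucas m) else 1.

Lemma lucas0 : lucas 0 = 0. Proof. by []. Qed.
Lemma lucas1 : lucas 1 = 1. Proof. by []. Qed.
Lemma lucasSS n : lucas n.+2 = w * lucas n.+1 - t *: lucas n.
Proof. by rewrite /lucas /=; case: (lucas_pair n). Qed.

Lemma lucasS n : lucas n.+1 = w * lucas n + lucas_shift n.
Proof. by case: n => [|n]; rewrite ?lucasSS // lucas0 lucas1 mulr0 add0r. Qed.

Lemma size_artin_schreier : size w = p.+1.
Proof.
rewrite /w -addrA -opprD size_polyDl ?size_polyXn // size_polyN.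
by rewrite size_polyDl size_polyX // ltnS (leq_trans (size_polyC_leq1 _)).
Qed.

Lemma monic_artin_schreier : w \is monic.
Proof.
rewrite monicE lead_coefE size_artin_schreier /w /=.
by rewrite !coefB coefXn coefX coefC eqxx (gtn_eqF p_gt1) (gtn_eqF (ltnW p_gt1)) !subr0.
Qed.

Lemma lucas_monic n : lucas n.+1 \is monic /\ size (lucas n.+1) = (p * n).+1.
Proof.
elim/ltn_ind: n => -[|[|n]] IH.
- by rewrite lucas1 monic1 size_poly1 muln0.
- by rewrite lucasSS lucas1 lucas0 scaler0 subr0 mulr1 monic_artin_schreier size_artin_schreier muln1.
have [m1 s1] := IH n.+1 (ltnSn _); have [_ s2] := IH n (leqnSn _).
have sw : size (w * lucas n.+2) = (p * n.+2).+1.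
  by rewrite size_monicM ?monic_artin_schreier ?monic_neq0 // size_artin_schreier s1; lia.
have lt: (size (- (t *: lucas n.+1))%R < size (w * lucas n.+2)%R)%N.
  by rewrite size_polyN (leq_ltn_trans (size_scale_leq _ _)) // s2 sw; nia.
rewrite lucasSS; split; last by rewrite size_polyDl.
by rewrite monicE lead_coefDl // -monicE monicMl ?monic_artin_schreier.
Qed.

Lemma size_lucasS n : size (lucas n.+1) = (p * n).+1.
Proof. by case: (lucas_monic n). Qed.

Lemma size_lucas_shift n : (size (lucas_shift n) <= (p * n).+1)%N.
Proof.
case: n => [|[|n]] /=; first by rewrite size_poly1.
  by rewrite lucas0 scaler0 oppr0 size_poly0.
by rewrite size_polyN (leq_trans (size_scale_leq _ _)) // size_lucasS; nia.
Qed.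

Lemma lucas_eval x y n : x ^+ 2 = w.[y] * x - t ->
  x ^+ n = (lucas_shift n).[y] + (lucas n).[y] * x.
Proof.
move=> Ex; elim: n => [|n IH]; first by rewrite expr0 /= !hornerE.
rewrite exprS IH mulrDr mulrCA -expr2 Ex lucasS !hornerE /=.
ring.
Qed.

(* the coordinates of x^i (t/x)^l in the basis 1, x *)
Definition conj_fst i l := lucas_shift i * lucas l.+1 + t *: (lucas i * lucas l).
Definition conj_snd i l := lucas i * lucas_shift l - lucas_shift i * lucas l.

(** Since [x (t/x) = t], raising both exponents by one only multiplies by [t], which leaves the case
    where one of them is 0. The two truncated differences add up to [|i - l|]. *)
Lemma size_conj_fst i l : (size (conj_fst i l) <= (p * ((i - l) + (l - i))).+1)%N.
Proof.
elim: i l => [|i IH] [|l].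
- by rewrite /conj_fst lucas0 lucas1 mul0r scaler0 addr0 mulr1 size_poly1.
- by rewrite /conj_fst lucas0 mul0r scaler0 addr0 mul1r size_lucasS subn0 add0n.
- by rewrite /conj_fst lucas0 lucas1 mulr0 scaler0 addr0 mulr1 addn0 subn0 size_lucas_shift.
suff -> : conj_fst i.+1 l.+1 = t *: conj_fst i l.
  by rewrite !subSS (leq_trans (size_scale_leq _ _)).
rewrite /conj_fst lucasSS (lucasS i) /= -!mul_polyC; ring.
Qed.

(** The same cancellation turns [x^i (t/x)^l] into [t^i (t/x)^(l - i)]. *)
Lemma conj_snd_lt i l : (i <= l)%N -> conj_snd i l = - (t ^+ i *: lucas (l - i)).
Proof.
elim: i l => [|i IH] [|l] //.
- by rewrite /conj_snd lucas0 mul0r sub0r mul1r expr0 scale1r.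
- by rewrite /conj_snd lucas0 mul0r sub0r mul1r expr0 scale1r.
move=> /IH h; rewrite subSS exprS -scalerA -scalerN -h.
rewrite /conj_snd (lucasS i) (lucasS l) /= -!mul_polyC; ring.
Qed.

(** The expression is the norm of [A + B x] to the [y]-line. If it vanished, then after division by
    the gcd the coprime [A] and [B] would each divide the square of the other, so both would be
    constant; but then [A B w] has degree [p] while [A^2 + t B^2] is constant. *)
Lemma norm_neq0 (A B : {poly E}) : t != 0 -> B != 0 ->
  A ^+ 2 + A * B * w + t *: B ^+ 2 != 0.
Proof.
move=> t0 B0; apply/negP => /eqP N0.
have g0 : gcdp A B != 0 by rewrite gcdp_eq0 negb_and B0 orbT.
have := coprimep_div_gcd (introT orP (or_intror B0) : (A != 0) || (B != 0)).
set A' := A %/ _; set B' := B %/ _ => cop.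
have EA : A = A' * gcdp A B by rewrite divpK ?dvdp_gcdl.
have EB : B = B' * gcdp A B by rewrite divpK ?dvdp_gcdr.
move: EA EB g0; set g := gcdp A B => EA EB g0.
have B'0 : B' != 0 by apply: contraNneq B0 => h; rewrite EB h mul0r.
have N' : A' ^+ 2 + A' * B' * w + t *: B' ^+ 2 = 0.
  apply: (mulIf (expf_neq0 2 g0)); rewrite mul0r -[RHS]N0 EA EB -!mul_polyC; ring.
have sB : size B' = 1%N.
  apply/eqP; rewrite -dvdp1.
  have: B' %| A' ^+ 2.
    apply/dvdpP; exists (- (A' * w + t *: B')); apply/eqP.
    rewrite -subr_eq0 -[X in _ == X]N' -!mul_polyC; apply/eqP; ring.
  by rewrite -(mulr1 (A' ^+ 2)) Gauss_dvdpr // coprimep_expr // coprimep_sym.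
have sA : size A' = 1%N.
  apply/eqP; rewrite -dvdp1.
  have: A' %| B' ^+ 2.
    rewrite -(dvdpZr _ _ t0); apply/dvdpP; exists (- (A' + B' * w)); apply/eqP.
    rewrite -subr_eq0 -[X in _ == X]N' -!mul_polyC; apply/eqP; ring.
  by rewrite -(mulr1 (B' ^+ 2)) Gauss_dvdpr // coprimep_expr.
have A'0 : A' != 0 by rewrite -size_poly_eq0 sA.
have: size (A' * B' * w) = p.+1.
  have w0 := monic_neq0 monic_artin_schreier.
  by rewrite size_mul ?mulf_neq0 // size_mul // sA sB size_artin_schreier.
have -> : A' * B' * w = - (A' ^+ 2 + t *: B' ^+ 2).
  apply/eqP; rewrite -subr_eq0 -[X in _ == X]N'; apply/eqP; ring.
rewrite size_polyN => h; have: (p.+1 <= 1)%N; last by lia.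
have s2 (P : {poly E}) : size P = 1%N -> (size (P ^+ 2) <= 1)%N.
  by move=> sP; have := size_poly_exp_leq P 2; rewrite sP.
rewrite -h (leq_trans (size_polyD _ _)) // geq_max s2 //.
by rewrite (leq_trans (size_scale_leq _ _)) // s2.
Qed.
End Lucas.

Lemma card_quadratic (E : finFieldType) (a b : E) :
  (#|[set x : E | x ^+ 2 == a * x - b]%R| <= 2)%N.
Proof.
have s3 : size ('X^2 - (a *: 'X - b%:P) : {poly E}) = 3%N.
  rewrite size_polyDl size_polyXn // size_polyN ltnS (leq_trans (size_polyD _ _)) //.
  rewrite geq_max (leq_trans (size_scale_leq _ _)) ?size_polyX //=.
  by rewrite size_polyN (leq_trans (size_polyC_leq1 _)).
rewrite cardE -ltnS -s3; apply: max_poly_roots; first by rewrite -size_poly_eq0 s3.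
  apply/allP => x; rewrite mem_enum inE /root => /eqP Ex.
  by rewrite !(hornerD, hornerN, hornerXn, hornerZ, hornerX, hornerC) Ex subrr.
exact: enum_uniq.
Qed.

Lemma prod_XsubC_exp_dvdp (E : fieldType) (N : {poly E}) (k : E -> nat) (s : seq E) :
  uniq s -> (forall y, y \in s -> ('X - y%:P) ^+ k y %| N) ->
  \prod_(y <- s) ('X - y%:P) ^+ k y %| N.
Proof.
elim: s => [|y s IH] /=; first by rewrite big_nil dvd1p.
case/andP=> ys us H; rewrite big_cons Gauss_dvdp ?H ?mem_head ?IH //.
  by move=> z zs; apply: H; rewrite inE zs orbT.
rewrite big_seq; elim/big_rec: _ => [|z P zs cP]; first exact: coprimep1.
rewrite coprimepMr cP andbT coprimep_expl // coprimep_expr //.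
by rewrite coprimep_XsubC2 // subr_eq0; apply: contraNneq ys => <-.
Qed.

(* A point contributes a root of the norm of A + B x; a fibre with two points forces both coordinates to vanish,
   hence a double root. *)
Lemma zeros_le_norm (E : finFieldType) (w A B : {poly E}) (t : E) :
  let N := A ^+ 2 + A * B * w + t *: B ^+ 2 in N != 0 ->
  let pts := [set z : E * E | z.1 ^+ 2 == w.[z.2] * z.1 - t] in
  (forall z, z \in pts -> A.[z.2] + B.[z.2] * z.1 = 0) ->
  (#|pts| <= (size N).-1)%N.
Proof.
move=> N N0 pts H.
pose k y := #|[set x | (x, y) \in pts]|.
have -> : #|pts| = (\sum_(y : E) k y)%N.
  rewrite -sum1_card (partition_big (fun z => z.2) predT) //=; apply: eq_bigr => y _.
  rewrite /k -sum1_card (reindex_onto (fun x => (x, y)) (fun z => z.1)) /=; last first.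
    by move=> [x y'] /= /andP[_ /eqP ->].
  by apply: eq_bigl => x; rewrite !eqxx !andbT [RHS]inE.
have kdvd y : ('X - y%:P) ^+ k y %| N.
  have [->|k0] := eqVneq (k y) 0%N; first by rewrite expr0 dvd1p.
  have [x1] : exists x, x \in [set x | (x, y) \in pts] by apply/set0Pn; rewrite -card_gt0 lt0n.
  rewrite inE => P1.
  have E1 := H _ P1; have := P1; rewrite inE /= => /eqP Q1.
  have [k1|k1] := leqP (k y) 1.
    have -> : k y = 1%N by lia.
    rewrite expr1 dvdp_XsubCl /root /N !(hornerD, hornerM, hornerZ, horner_exp).
    have -> : A.[y] = - (B.[y] * x1) by apply/eqP; rewrite -subr_eq0 opprK E1.
    apply/eqP; transitivity (B.[y] ^+ 2 * (x1 ^+ 2 - (w.[y] * x1 - t))); first by ring.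
    by rewrite Q1 subrr mulr0.
  have [x2] : exists x, x \in [set x | (x, y) \in pts] :\ x1.
    by apply/set0Pn; rewrite -card_gt0; move: k1; rewrite /k (cardsD1 x1) inE P1.
  rewrite !inE /= => /andP[x21 Q2'].
  have E2 := H (x2, y); rewrite inE /= in E2; move/(_ Q2'): E2 => E2; move/eqP: Q2' => Q2.
  have By : B.[y] = 0.
    have: B.[y] * (x1 - x2) == 0.
      rewrite -[X in _ == X](subrr (A.[y] + B.[y] * x1)) {2}E1 -[X in _ == _ + _ - X]E2.
      by apply/eqP; ring.
    by rewrite mulf_eq0 subr_eq0 [x1 == _]eq_sym (negbTE x21) orbF => /eqP.
  have Ay : A.[y] = 0 by move: E1; rewrite By mul0r addr0.
  have k2 : (k y <= 2)%N.
    rewrite /k (_ : [set x | _] = [set x | x ^+ 2 == w.[y] * x - t]) ?card_quadratic //.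
    by apply/setP => x; rewrite !inE.
  have -> : k y = 2%N by lia.
  rewrite /N.
  have [A' ->] : exists A', A = A' * ('X - y%:P) by apply/dvdpP; rewrite dvdp_XsubCl /root Ay.
  have [B' ->] : exists B', B = B' * ('X - y%:P) by apply/dvdpP; rewrite dvdp_XsubCl /root By.
  apply/dvdpP; exists (A' ^+ 2 + A' * B' * w + t *: B' ^+ 2).
  rewrite -!mul_polyC; ring.
have D : \prod_(y <- enum E) ('X - y%:P) ^+ k y %| N.
  by apply: prod_XsubC_exp_dvdp => [|y _]; rewrite ?enum_uniq.
have := dvdp_leq N0 D.
have -> : size (\prod_(y <- enum E) ('X - y%:P) ^+ k y) = (\sum_(y : E) k y).+1.
  rewrite -big_enum /=; elim: (enum E) => [|y s IH]; first by rewrite !big_nil size_poly1.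
  rewrite !big_cons size_monicM ?monic_exp ?monicXsubC //; last first.
    by rewrite -size_poly_gt0 IH.
  by rewrite IH size_exp_XsubC addSn /= addnS.
by case: (size N).
Qed.

(** * Stepanov's method *)

Section Combinations.
Variables (E : fieldType) (p : nat) (t e : E).
Hypothesis p_gt1 : (1 < p)%N.
Local Notation w := (@artin_schreier E p e).
Local Notation lucas := (@lucas E p t e).
Local Notation lucas_shift := (@lucas_shift E p t e).
Variables (I : finType) (i j : I -> nat) (c : I -> E).

Definition comb_fst : {poly E} := \sum_k c k *: ('X^(j k) * lucas_shift (i k)).
Definition comb_snd : {poly E} := \sum_k c k *: ('X^(j k) * lucas (i k)).

Lemma comb_eval x y : x ^+ 2 = w.[y] * x - t ->
  comb_fst.[y] + comb_snd.[y] * x = \sum_k c k * (x ^+ i k * y ^+ j k).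
Proof.
move=> Ex; rewrite !horner_sum mulr_suml -big_split /=; apply: eq_bigr => k _.
rewrite !(hornerZ, hornerM, hornerXn) (@lucas_eval E p t e x y (i k) Ex); ring.
Qed.

Lemma size_sum_leq (G : I -> {poly E}) M :
  (forall k, (size (G k) <= M)%N) -> (size (\sum_k G k)%R <= M)%N.
Proof. by move=> H; apply: (leq_trans (size_sum _ _ _)); apply/bigmax_leqP. Qed.

Lemma size_XnM_leq d (P : {poly E}) m : (size P <= m.+1)%N -> (size ('X^d * P)%R <= (d + m).+1)%N.
Proof.
move=> sP; apply: (leq_trans (size_polyMleq _ _)); rewrite size_polyXn; lia.
Qed.

(** At the place at infinity where [x] vanishes to order [p], [y] has a simple pole, so this says
    that [x^i y^j] has no pole there. *)
Hypothesis regular : forall k, (j k <= p * i k)%N.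

(** The norm is expanded as the function times its conjugate: the terms [k] and [l] give
    [x^(i k) (t/x)^(i l) y^(j k + j l)], of degree at most [p |i k - i l| + j k + j l], and
    regularity absorbs the [j] that goes with the smaller [i]. Estimating the three summands one by
    one would only give about [2 M]. *)
Lemma size_comb_norm M : (forall k, p * i k + j k <= M)%N ->
  (size (comb_fst ^+ 2 + comb_fst * comb_snd * w + t *: comb_snd ^+ 2)%R <= M.+1)%N.
Proof.
move=> HM.
have -> : comb_fst ^+ 2 + comb_fst * comb_snd * w + t *: comb_snd ^+ 2 =
  \sum_k \sum_l (c k * c l) *: ('X^(j k + j l) * conj_fst E p t e (i k) (i l)).
  transitivity (comb_fst * (w * comb_snd + comb_fst) + t *: (comb_snd * comb_snd)).
    by rewrite -!mul_polyC; ring.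
  have -> : w * comb_snd + comb_fst = \sum_k c k *: ('X^(j k) * lucas (i k).+1).
    rewrite mulr_sumr -big_split /=; apply: eq_bigr => k _.
    by rewrite lucasS -!mul_polyC; ring.
  rewrite !mulr_suml scaler_sumr -big_split /=; apply: eq_bigr => k _.
  rewrite !mulr_sumr scaler_sumr -big_split /=; apply: eq_bigr => l _.
  by rewrite /conj_fst exprD -!mul_polyC polyCM; ring.
apply: size_sum_leq => k; apply: size_sum_leq => l.
apply: (leq_trans (size_scale_leq _ _)).
apply: (leq_trans (size_XnM_leq _ _ _ (@size_conj_fst E p t e p_gt1 _ _))).
have := HM k; have := HM l; have := regular k; have := regular l; rewrite ltnS.
by case: (leqP (i k) (i l)) => h; nia.
Qed.

(* A function of y alone without pole above x = 0 is constant: multiply by (t/x)^K and compare x-coordinates. *)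
Lemma comb_snd_eq0_size : comb_snd = 0 -> (size comb_fst <= 1)%N.
Proof.
move=> B0; pose K := (\max_k i k).+1.
have iK k : (i k < K)%N by rewrite ltnS; apply: leq_bigmax.
have Eq : comb_fst * lucas K =
    \sum_k (c k * t ^+ i k) *: ('X^(j k) * lucas (K - i k)).
  transitivity (- (comb_snd * lucas_shift K - comb_fst * lucas K)).
    by rewrite B0 mul0r sub0r opprK.
  rewrite !mulr_suml -sumrB -sumrN; apply: eq_bigr => k _.
  transitivity (c k *: ('X^(j k) * - conj_snd E p t e (i k) K)).
    by rewrite /conj_snd -!mul_polyC; ring.
  by rewrite conj_snd_lt ?(ltnW (iK k)) // opprK -scalerA -scalerAr.
have [->|A0] := eqVneq comb_fst 0; first by rewrite size_poly0.
have [mK sK] := @lucas_monic E p t e p_gt1 (\max_k i k).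
have : (size (comb_fst * lucas K)%R <= (p * (\max_k i k)).+1)%N.
  rewrite Eq; apply: size_sum_leq => k.
  apply: (leq_trans (size_scale_leq _ _)).
  have := iK k; rewrite /K ltnS => ik.
  have sl : (size (lucas (K - i k)%N) <= (p * (\max_k i k - i k)).+1)%N.
    by rewrite /K subSn // size_lucasS.
  apply: (leq_trans (size_XnM_leq _ _ _ sl)).
  by rewrite ltnS; have := regular k; nia.
by rewrite size_Mmonic // sK; lia.
Qed.
End Combinations.

Lemma free_staircase (E : fieldType) (d N : nat) (f : nat -> {poly E}) (c : nat -> E) :
  (forall n, size (f n) = (n + d).+1) ->
  \sum_(n < N) c n *: f n = 0 -> forall n, (n < N)%N -> c n = 0.
Proof.
move=> sf; elim: N => // N IH; rewrite big_ord_recr /= => H.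
have cN : c N = 0.
  have := congr1 (fun P : {poly E} => P`_(N + d)) H.
  rewrite coefD coefZ coef0 nth_default ?add0r; last first.
    apply: (leq_trans (size_sum _ _ _)); apply/bigmax_leqP => i _.
    by apply: (leq_trans (size_scale_leq _ _)); rewrite sf ltn_add2r.
  move/eqP; rewrite mulf_eq0 => /orP[/eqP //|].
  have : lead_coef (f N) != 0 by rewrite lead_coef_eq0 -size_poly_gt0 sf.
  by rewrite lead_coefE sf /= => /negbTE ->.
rewrite cN scale0r addr0 in H.
by move=> n; rewrite ltnS leq_eqVlt => /orP[/eqP ->|/IH]; last apply.
Qed.

Lemma nontrivial_relation (E : fieldType) (m n : nat) (f : 'I_m -> 'I_n -> E) :
  (n < m)%N -> exists2 d : 'I_m -> E, exists k, d k != 0 & forall l, \sum_k d k * f k l = 0.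
Proof.
move=> nm; pose M := \matrix_(k, l) f k l.
have : kermx M != 0.
  rewrite kermx_eq0 -row_leq_rank -ltnNge.
  exact: leq_ltn_trans (rank_leq_col _) nm.
case/rowV0Pn => v /sub_kermxP vM v0; exists (v 0).
  by case/rV0Pn: v0 => k vk; exists k.
move=> l; have := congr1 (fun A : 'rV_n => A 0 l) vM; rewrite !mxE => h; rewrite -[RHS]h.
  by apply: eq_bigr => k _; rewrite mxE.
Qed.

Lemma expf_pchar_sum (R : comNzRingType) (p k : nat) (I : finType) (F : I -> R) :
  p \in [pchar R] -> (\sum_i F i) ^+ (p ^ k) = \sum_i F i ^+ (p ^ k).
Proof.
move=> pR; have pp := pcharf_prime pR.
apply: (big_morph (fun x => x ^+ (p ^ k))) => [x y|].
  by rewrite exprDn_pchar // pnatX pnatE // pR.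
by rewrite expr0n expn_eq0 (gtn_eqF (prime_gt0 pp)).
Qed.

Section Stepanov.
Variables (E : finFieldType) (p k r : nat) (t e : E).
Hypothesis rE : r = (p ^ k)%N.
Hypothesis pE : p \in [pchar E].
Hypothesis cardE : #|E| = (r ^ 2)%N.
Hypothesis r_large : (p.+2 < r)%N.
Hypothesis t0 : t != 0.
Local Notation w := (@artin_schreier E p e).

Let p_gt1 : (1 < p)%N. Proof. exact: prime_gt1 (pcharf_prime pE). Qed.
Let r_gt0 : (0 < r)%N. Proof. exact: leq_ltn_trans r_large. Qed.
Let frob_r (I : finType) (G : I -> E) : (\sum_i G i) ^+ r = \sum_i G i ^+ r.
Proof. by rewrite rE; exact: expf_pchar_sum. Qed.
Let frob_Q (x : E) : x ^+ r ^+ r = x.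
Proof. by rewrite -exprM -[RHS]expf_card cardE mulnn. Qed.

(* The monomials x^i y^j with 0 <= j < p <= i p are indexed by their pole order v = i p + j at infinity;
   an index n < r m encodes a pair of such monomials. *)
Local Notation m := (r + p.+1)%N.
Local Notation lo n := (p + n %% r)%N.
Local Notation hi n := (p + n %/ r)%N.

(* G = sum_n d_n x^(iG n) y^(jG n) is made to vanish on the curve; with d = c^r, the function
   H = sum_n c_n x^(iH n) y^(jH n) has nonzero x-coordinate (its terms have distinct pole orders), and H^r = G = 0 at
   rational points because z^(r^2) = z there. *)
Lemma stepanov_bound :
  (#|[set z : E * E | z.1 ^+ 2 == w.[z.2] * z.1 - t]%R| <= r ^ 2 + (2 * p + 2) * r)%N.
Proof.
pose iG n := (r * (lo n %/ p) + hi n %/ p)%N; pose jG n := (r * (lo n %% p) + hi n %% p)%N.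
pose iH n := (lo n %/ p + r * (hi n %/ p))%N; pose jH n := (lo n %% p + r * (hi n %% p))%N.
have wt v : (p * (v %/ p) + v %% p = v)%N by rewrite mulnC -divn_eq.
(* The offset [p] in [lo] and [hi] makes every quotient by [p] positive; regularity of the monomials
   follows. *)
have ge1 v : (0 < (p + v) %/ p)%N by rewrite divn_gt0 ?leq_addr // ltnW.
have reg v : ((p + v) %% p <= p * ((p + v) %/ p))%N.
  by apply: (@leq_trans p); [rewrite ltnW // ltn_mod ltnW | rewrite leq_pmulr].
have lo_lt n : (n %% r < r)%N by rewrite ltn_mod.
have hi_lt (n : 'I_(r * m)) : (n %/ r < m)%N.
  by move: (ltn_ord n); move: (nat_of_ord n) => v; rewrite ltn_divLR // mulnC.
have wtG n : (p * iG n + jG n = r * lo n + hi n)%N.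
  by rewrite /iG /jG mulnDr addnACA mulnCA -mulnDr !wt.
have wtH n : (p * iH n + jH n = lo n + r * hi n)%N.
  by rewrite /iH /jH mulnDr addnACA [(p * (r * _))%N]mulnCA -mulnDr !wt.
have regG n : (jG n <= p * iG n)%N.
  by rewrite mulnDr mulnCA leq_add ?leq_mul2l ?reg ?orbT.
have regH n : (jH n <= p * iH n)%N.
  by rewrite mulnDr [(p * (r * _))%N]mulnCA leq_add ?leq_mul2l ?reg ?orbT.
have iG_gt0 n : (0 < iG n)%N by rewrite addn_gt0 ge1 orbT.
have iH_gt0 n : (0 < iH n)%N by rewrite addn_gt0 ge1.
(* [D] bounds the size of the [x]-coordinate of [G], so [D] equations kill it; the other coordinate
   is then constant and one last equation kills it. Unknowns outnumber equations because
   [p + 2 < r]. *)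
pose N := (r * m)%N; pose D := (r * (p + r.-1) + m)%N.
have DN : (D.+1 < N)%N.
  have -> : N = (r * (p + r.-1) + r * 2)%N by rewrite -mulnDr; congr (r * _)%N; lia.
  by rewrite /D -addnS ltn_add2l; lia.
pose BG n : {poly E} := 'X^(jG n) * lucas E p t e (iG n).
pose AG n : {poly E} := 'X^(jG n) * lucas_shift E p t e (iG n).
have [d [n0 d0] Hd] := @nontrivial_relation E N D.+1
   (fun n l => if (l < D)%N then (BG n)`_l else (AG n)`_0) DN.
have szB i j : (0 < i)%N -> size ('X^j * lucas E p t e i) = ((p * i + j).+1 - p)%N.
  case: i => // i _; have [mi si] := @lucas_monic E p t e p_gt1 i.
  by rewrite size_monicM ?monicXn ?monic_neq0 // size_polyXn si mulnS; lia.
have BG0 : comb_snd E p t e _ (iG \o val) (jG \o val) d = 0.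
  apply/polyP => l; rewrite coef0 /comb_snd.
  have [lD|lD] := ltnP l D.
    have := Hd (Ordinal (ltnW lD : (l < D.+1)%N)); rewrite /= lD => h; rewrite -[RHS]h.
    by rewrite coef_sum; apply: eq_bigr => n _; rewrite coefZ.
  apply: nth_default; apply: leq_trans lD; apply: size_sum_leq => n.
  apply: (leq_trans (size_scale_leq _ _)); rewrite /= szB // wtG /D.
  have : (r * lo n <= r * (p + r.-1))%N.
    by rewrite leq_mul2l leq_add2l; apply/orP; right; have := lo_lt n; lia.
  by have := hi_lt n; lia.
have AG0 : comb_fst E p t e _ (iG \o val) (jG \o val) d = 0.
  have : (size (comb_fst E p t e _ (iG \o val) (jG \o val) d) <= 1)%N.
    by apply: comb_snd_eq0_size BG0 => // n /=.
  move/size1_polyC => ->; have := Hd ord_max; rewrite /= ltnn => h.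
  rewrite (_ : _`_0 = 0) // -[RHS]h /comb_fst coef_sum.
  by apply: eq_bigr => n _; rewrite coefZ.
pose c n := d n ^+ r.
have cr n : c n ^+ r = d n by rewrite /c frob_Q.
pose A := comb_fst E p t e _ (iH \o val) (jH \o val) c.
pose B := comb_snd E p t e _ (iH \o val) (jH \o val) c.
have B0 : B != 0.
  apply: contraNneq d0 => B0.
  pose c' n := if insub n is Some n' then c n' else 0.
  have cc' (n : 'I_N) : c' n = c n by rewrite /c' valK.
  suff h : c' n0 = 0 by rewrite -cr -cc' h expr0n (gtn_eqF r_gt0).
  (* The pole order [lo n + r * hi n] equals [n + p + r * p] by division with remainder, so the
     [n]-th term of [B] has degree [n + r * p]. *)
  apply: (@free_staircase E (r * p) N (fun n => 'X^(jH n) * lucas E p t e (iH n)) c') => //.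
    move=> n; rewrite szB // wtH mulnDr [in RHS](divn_eq n r) [(_ %/ _ * _)%N]mulnC; lia.
  by rewrite -[RHS]B0; apply: eq_bigr => n _; rewrite cc'.
have Nz := @norm_neq0 E p t e p_gt1 A B t0 B0.
apply: leq_trans (zeros_le_norm _ w A B t Nz _) _; last first.
  (* The right-hand side comes from the largest digits of [n]. As [m - 1 = r + p], this pole order
     is [r^2 + (2 p + 1) r + p - 1], and [p < r]. *)
  have : (size (A ^+ 2 + A * B * w + t *: B ^+ 2)%R <= (r * (p + m.-1) + (p + r.-1)).+1)%N.
    apply: size_comb_norm => // n /=; first exact: regH.
    rewrite wtH addnC leq_add //.
      by rewrite leq_mul2l leq_add2l; apply/orP; right; have := hi_lt n; lia.
    by rewrite leq_add2l; have := lo_lt n; lia.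
  case: (size _) => // s; rewrite ltnS => /leq_trans; apply.
  rewrite addnS /= -mulnn !mulnDr !mulnDl; lia.
move=> [x y]; rewrite inE /= => /eqP Ex.
rewrite (comb_eval E p t e _ _ _ _ x y Ex).
suff h : (\sum_i c i * (x ^+ iH i * y ^+ jH i)) ^+ r = 0.
  by apply/eqP; move/eqP: h; rewrite expf_eq0 r_gt0.
have := comb_eval E p t e _ (iG \o val) (jG \o val) d x y Ex.
rewrite AG0 BG0 !horner0 mul0r addr0 => h; rewrite frob_r [RHS]h.
apply: eq_bigr => n _ /=.
have Hr (z : E) a b : z ^+ (a + r * b) ^+ r = z ^+ (r * a + b).
  by rewrite !exprD exprMn -!exprM [(_ * b * r)%N]mulnAC mulnn -cardE [z ^+ (_ * b)]exprM expf_card mulnC.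
by rewrite !exprMn cr !Hr.
Qed.
End Stepanov.

(** * Additive characters and Kloosterman sums *)

(** In characteristic [p], invariance under [x -> x^p] makes [psi] trivial on all [y^p - y], which
    ties it to the curve above. These are the nontrivial characters that factor through the trace to
    the prime field. *)
Definition artin_character (E : finFieldType) (p : nat) (psi : E -> algC) :=
  [/\ psi 0 = 1, {morph psi : x y / x + y >-> x * y}, forall x, psi (x ^+ p) = psi x
    & exists z, psi z != 1].

Definition kloosterman (E : finFieldType) (psi : E -> algC) (u : E) :=
  \sum_(x | x != 0) psi (x + u / x).

Section Characters.
Variables (E : finFieldType) (p : nat) (psi : E -> algC).
Hypothesis pE : p \in [pchar E].
Hypothesis psi_char : artin_character E p psi.

Let psi0 : psi 0 = 1. Proof. by case: psi_char. Qed.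
Let psiD : {morph psi : x y / x + y >-> x * y}. Proof. by case: psi_char. Qed.
Let psiX x : psi (x ^+ p) = psi x. Proof. by case: psi_char. Qed.

Lemma char_mulrn x n : psi (x *+ n) = psi x ^+ n.
Proof. by elim: n => [|n IH]; rewrite ?mulr0n ?psi0 // mulrS psiD IH exprS. Qed.

Lemma char_norm x : `|psi x| = 1.
Proof.
have p0 : (0 < p)%N := prime_gt0 (pcharf_prime pE).
by apply/eqP; rewrite -(@pexpr_eq1 _ _ p) // -normrX -char_mulrn mulrn_pchar // psi0 normr1.
Qed.

Lemma char_conj x : (psi x)^* = psi (- x).
Proof.
have n0 : psi x != 0 by rewrite -normr_eq0 char_norm oner_eq0.
by apply: (mulfI n0); rewrite -normCK char_norm expr1n -psiD subrr psi0.
Qed.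

Lemma char_sum : \sum_x psi x = 0.
Proof.
case: psi_char => _ _ _ [z z1].
have: \sum_x psi x = psi z * \sum_x psi x.
  rewrite mulr_sumr (reindex_inj (addrI z)) /=; apply: eq_bigr => x _; exact: psiD.
move/eqP; rewrite -subr_eq0 -{1}[\sum_x psi x]mul1r -mulrBl mulf_eq0 subr_eq0 eq_sym.
by rewrite (negbTE z1) => /eqP.
Qed.

Lemma char_sum_mul z : \sum_s psi (s * z) = if z == 0 then #|E|%:R else 0.
Proof.
have [->|z0] := eqVneq z 0.
  by under eq_bigr do rewrite mulr0 psi0; rewrite sumr_const.
rewrite -[RHS]char_sum (reindex_inj (mulIf (invr_neq0 z0))) /=.
by apply: eq_bigr => x _; rewrite mulfVK.
Qed.

Lemma char_sum_neq0 z : \sum_(s | s != 0) psi (s * z) = (if z == 0 then #|E|%:R else 0) - 1.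
Proof. by rewrite -char_sum_mul [in RHS](bigD1 0) //= mul0r psi0 addrC addrK. Qed.

Lemma kloosterman_real u : (kloosterman E psi u)^* = kloosterman E psi u.
Proof.
rewrite rmorph_sum /= /kloosterman (reindex_inj oppr_inj) /=.
apply: eq_big => x; first by rewrite oppr_eq0.
by move=> _; rewrite char_conj invrN mulrN opprD !opprK.
Qed.

Lemma kloosterman_trivial u : `|kloosterman E psi u| <= #|E|%:R.
Proof.
apply: (le_trans (ler_norm_sum _ _ _)).
under eq_bigr do rewrite char_norm.
by rewrite sumr_const ler_nat; apply: max_card.
Qed.

(** With [P e] the number of points of the curve of parameter [e], the sum of [psi e * P e] is
    [#|E| K]. As [psi] sums to 0, [P e] may be replaced by [P e - M], which has constant sign; so an
    upper bound on each [P e] and the exact total of the [P e] suffice, giving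
    [|K| <= M - (#|E| - 1)]. *)
Lemma kloosterman_stepanov u k : u != 0 -> #|E| = ((p ^ k) ^ 2)%N ->
  `|kloosterman E psi u| <= ((2 * p + 3) * p ^ k)%:R.
Proof.
move=> u0 cE; set r := (p ^ k)%N; have p1 := prime_gt1 (pcharf_prime pE).
have r0 : (0 < r)%N by rewrite expn_gt0; lia.
(* For small [r] the trivial bound [r^2] is already good enough. *)
have [rs|rl] := leqP r p.+2.
  apply: (le_trans (kloosterman_trivial u)); rewrite ler_nat cE -/r; nia.
pose M := (r ^ 2 + (2 * p + 2) * r)%N.
pose P e := #|[set z : E * E | z.1 ^+ 2 == (artin_schreier E p e).[z.2] * z.1 - u]|.
have PM e : (P e <= M)%N by apply: (@stepanov_bound E p k r u e).
pose K := kloosterman E psi u.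
have inP e (z : E * E) : (z.1 ^+ 2 == (artin_schreier E p e).[z.2] * z.1 - u) =
    (z.1 != 0) && (e == z.2 ^+ p - z.2 - (z.1 + u / z.1)).
  rewrite /artin_schreier !(hornerD, hornerN, hornerXn, hornerX, hornerC).
  have [->|x0] /= := eqVneq z.1 0.
    by rewrite expr0n mulr0 sub0r eq_sym oppr_eq0 (negbTE u0).
  rewrite -[RHS](inj_eq (mulIf x0)) -subr_eq0 -[RHS]subr_eq0; congr (_ == 0).
  by field.
have PE e : (P e)%:R = \sum_(z : E * E | (z.1 != 0) && (e == z.2 ^+ p - z.2 - (z.1 + u / z.1))) 1 :> algC.
  by rewrite sumr_const; congr (_ %:R); apply: eq_card => z; rewrite [LHS]inE inP.
have sumP (g : E -> algC) : \sum_e g e * (P e)%:R =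
    \sum_(z : E * E | z.1 != 0) g (z.2 ^+ p - z.2 - (z.1 + u / z.1)).
  rewrite (partition_big (fun z => z.2 ^+ p - z.2 - (z.1 + u / z.1)) predT) //=.
  apply: eq_bigr => e _; rewrite PE mulr_sumr; apply: eq_big => z; first by rewrite [e == _]eq_sym.
  by case/andP=> _ /eqP ->; rewrite mulr1.
(* Over a point [(x, y)], [psi e = psi (- (x + u/x))] because [psi] kills [y^p - y]; so [y] is free
   and contributes the factor [#|E|]. *)
have Q1 : \sum_e psi e * (P e)%:R = #|E|%:R * K.
  rewrite sumP -[K]kloosterman_real rmorph_sum /= mulr_sumr.
  rewrite (eq_bigl (fun z : E * E => (z.1 != 0) && true)); last by move=> z; rewrite andbT.
  rewrite -(pair_big (fun x : E => x != 0) predT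
     (fun x y => psi (y ^+ p - y - (x + u / x)))) /=; apply: eq_bigr => x _.
  rewrite char_conj (eq_bigr (fun _ => psi (- (x + u / x)))).
    by rewrite sumr_const mulr_natl.
  by move=> y _; rewrite !psiD psiX -psiD subrr psi0 mul1r.
have Q0 : \sum_e (P e)%:R = (#|E| * #|E|.-1)%:R :> algC.
  transitivity (\sum_e 1 * (P e)%:R : algC); first by apply: eq_bigr => e _; rewrite mul1r.
  rewrite (sumP (fun _ => 1)) sumr_const; congr (_ %:R).
  rewrite -(cardC1 (0 : E)) mulnC -cardX; apply: eq_card => z.
  by rewrite !inE andbT.
have q0 : 0 < #|E|%:R :> algC by rewrite ltr0n cE expn_gt0 r0.
rewrite -(ler_pM2l q0) -[X in X * `|_| <= _]normr_nat -normrM -Q1.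
have -> : \sum_e psi e * (P e)%:R = \sum_e psi e * ((P e)%:R - M%:R).
  under [RHS]eq_bigr do rewrite mulrBr; rewrite sumrB -mulr_suml char_sum mul0r subr0 //.
apply: (le_trans (ler_norm_sum _ _ _)).
apply: (@le_trans _ _ (\sum_e (M%:R - (P e)%:R))).
  apply: ler_sum => e _; rewrite normrM char_norm mul1r distrC ger0_norm //.
  by rewrite subr_ge0 ler_nat.
rewrite sumrB Q0 sumr_const -mulrnA lerBlDr -natrM -natrD ler_nat.
have : (0 < #|E|)%N by rewrite cE expn_gt0 r0.
rewrite cE /M -/r; nia.
Qed.
End Characters.

(** * Extensions of finite fields *)

(** [L] is a splitting field of [X^m - X] with [m = #|F|^n]. The roots are distinct, the derivative
    being -1, and form the fixed field of the [n]-th power of the Frobenius; being a field, they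
    fill [L]. *)
Lemma finField_extension (F : finFieldType) (p h n : nat) :
  prime p -> #|F| = (p ^ h)%N -> (0 < n)%N ->
  exists (L : finFieldType) (iota : {rmorphism F -> L}), #|L| = (#|F| ^ n)%N.
Proof.
move=> pr_p cF n_gt0; set m := (#|F| ^ n)%N.
have pF := card_finPcharP cF pr_p.
have F_gt1 : (1 < #|F|)%N := finNzRing_gt1 F.
have h_gt0 : (0 < h)%N by case: h cF F_gt1 => // ->; rewrite expn0.
have m_gt1 : (1 < m)%N by rewrite -[1%N](expn0 #|F|) ltn_exp2l.
have sizeP (R : nzRingType) : size ('X^m - 'X : {poly R}) = m.+1.
  by rewrite size_polyDl size_polyXn // size_polyN size_polyX.
have q0 : 'X^m - 'X != 0 :> {poly F} by rewrite -size_poly_eq0 sizeP.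
have [L splitL] := FinSplittingFieldFor q0.
rewrite rmorphB rmorphXn /= map_polyX in splitL.
have [zs Dz defL] := splitL.
have m0 : m%:R = 0 :> L.
  have pL : p \in [pchar L] by rewrite pchar_lalg.
  apply/eqP; rewrite -(dvdn_pcharf pL) /m cF -expnM.
  by rewrite dvdn_exp // muln_gt0 h_gt0.
have Uzs : uniq zs.
  rewrite -separable_prod_XsubC -(eqp_separable Dz) unlock derivB derivXn derivX.
  by rewrite -mulr_natl -polyC_natr m0 polyC0 mul0r sub0r -[- 1]scaleN1r coprimepZr ?coprimep1 // oppr_eq0 oner_eq0.
exists (FinFieldExtType L), (in_alg L); rewrite -/m.
have [a _ Da] := finField_galois_generator (sub1v {:L}%AS).
rewrite dimv1 expn1 in Da.
pose Em := fixedSpace (a ^+ n)%g.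
have in_zs : zs =i Em.
  move=> z; rewrite -root_prod_XsubC -(eqp_root Dz) (sameP fixedSpaceP eqP).
  rewrite /root !hornerE subr_eq0 /= /m; congr (_ == z).
  elim: (n) => [|i IHi]; first by rewrite gal_id.
  by rewrite expgSr expnSr exprM IHi galM ?Da ?memvf.
have defEm : Em = {:L}%VS.
  apply/eqP; rewrite eqEsubv subvf -defL -[Em]subfield_closed agenvS //.
  by rewrite subv_add sub1v; apply/span_subvP=> z; rewrite in_zs.
suffices /eq_card-> : FinFieldExtType L =i zs.
  apply: succn_inj; rewrite (card_uniqP _) //= -(size_prod_XsubC _ id).
  by rewrite -(eqp_size Dz) sizeP.
by move=> z; rewrite in_zs defEm memvf.
Qed.

Section Extension.
Variables (F L : finFieldType) (iota : {rmorphism F -> L}) (p h n : nat).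
Hypothesis pr_p : prime p.
Hypothesis cF : #|F| = (p ^ h)%N.
Hypothesis cL : #|L| = (#|F| ^ n)%N.
Hypothesis n_gt0 : (0 < n)%N.
Local Notation q := #|F|.

Lemma ext_pchar : p \in [pchar L].
Proof. by rewrite (fmorph_pchar iota) (card_finPcharP cF). Qed.

Lemma frobenius_sum (I : finType) (G : I -> L) i :
  (\sum_k G k) ^+ (q ^ i) = \sum_k G k ^+ (q ^ i).
Proof. by rewrite cF -expnM; apply: expf_pchar_sum ext_pchar. Qed.

Lemma frobeniusD (x y : L) i : (x + y) ^+ (q ^ i) = x ^+ (q ^ i) + y ^+ (q ^ i).
Proof. by rewrite cF -expnM exprDn_pchar // pnatX pnatE // ext_pchar. Qed.

Lemma iota_frobenius (x : F) i : iota x ^+ (q ^ i) = iota x.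
Proof. by elim: i => [|i IH]; rewrite ?expr1 // expnSr exprM IH -rmorphXn expf_card. Qed.

Definition descend (x : L) : F := odflt 0 [pick y | iota y == x].

(** The default 0 in [descend] is not reached here: [X^q - X] splits over [F], so it has no root in
    [L] outside the image of [iota]. *)
Lemma descendK x : x ^+ q = x -> iota (descend x) = x.
Proof.
move=> xq; rewrite /descend; case: pickP => [y /eqP //|H].
have := congr1 (fun P => (map_poly iota P).[x]) (finField_genPoly F).
rewrite rmorphB rmorphXn /= map_polyX hornerD hornerN hornerXn hornerX xq subrr.
rewrite rmorph_prod horner_prod => /esym/eqP; rewrite prodf_seq_eq0.
case/hasP => y _ /=; rewrite rmorphB /= map_polyX map_polyC hornerXsubC subr_eq0 eq_sym.
by rewrite H.
Qed.

Definition conj_trace (x : L) := \sum_(i < n) x ^+ (q ^ i).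

Definition trace_to (x : L) : F := descend (conj_trace x).

(** The Frobenius permutes the summands cyclically, since [x^(q^n) = x]. *)
Lemma trace_toE x : iota (trace_to x) = conj_trace x.
Proof.
apply: descendK; rewrite -{1}[q]expn1 frobenius_sum /conj_trace.
case: n n_gt0 cL => // m _ cL'.
rewrite big_ord_recr [in RHS]big_ord_recl /= addrC; congr (_ + _).
  by rewrite -exprM -expnSr expr1 -cL' expf_card.
by apply: eq_bigr => i _; rewrite -exprM -expnD addn1.
Qed.

Lemma trace_toD x y : trace_to (x + y) = trace_to x + trace_to y.
Proof.
apply: (fmorph_inj iota); rewrite rmorphD !trace_toE -big_split /=.
by apply: eq_bigr => i _; exact: frobeniusD.
Qed.

Lemma trace_toZ c x : trace_to (iota c * x) = c * trace_to x.
Proof.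
apply: (fmorph_inj iota); rewrite rmorphM !trace_toE mulr_sumr.
by apply: eq_bigr => i _; rewrite exprMn iota_frobenius.
Qed.

Lemma trace_toX x : trace_to (x ^+ p) = trace_to x ^+ p.
Proof.
apply: (fmorph_inj iota); rewrite rmorphXn !trace_toE /conj_trace.
have -> := expf_pchar_sum L p 1 _ (fun i : 'I_n => x ^+ (q ^ i)) ext_pchar.
by apply: eq_bigr => i _; rewrite -!exprM mulnC.
Qed.

(** The trace is a polynomial function of degree [q^(n-1)], too small to vanish at all [q^n]
    elements. *)
Lemma trace_to_nontrivial : exists x, trace_to x != 0.
Proof.
apply/existsP; apply: contraT; rewrite negb_exists => /forallP H.
pose T : {poly L} := \sum_(i < n) 'X^(q ^ i).
have q_gt1 : (1 < q)%N := finNzRing_gt1 F.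
have sT : size T = (q ^ n.-1).+1.
  rewrite /T; case: n n_gt0 => // m _; rewrite big_ord_recr /= addrC size_polyDl size_polyXn //.
  rewrite ltnS; apply: (leq_trans (size_sum _ _ _)); apply/bigmax_leqP => i _.
  by rewrite size_polyXn ltn_exp2l.
have T0 : T != 0 by rewrite -size_poly_eq0 sT.
have := max_poly_roots T0 (_ : all (root T) (enum L)) (enum_uniq L).
rewrite -cardE cL sT ltnS leq_exp2l // => /(_ _).
have -> : all (root T) (enum L).
  apply/allP => x _; rewrite /root horner_sum; apply/eqP.
  rewrite -[RHS](rmorph0 iota) -(eqP (negPn (H x))) trace_toE.
  by apply: eq_bigr => i _; rewrite hornerXn.
by move=> /(_ isT); case: n n_gt0 => // m _; rewrite ltnn.
Qed.

Lemma lift_character (psi : F -> algC) :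
  artin_character F p psi -> artin_character L p (fun x => psi (trace_to x)).
Proof.
case=> psi0 psiD psiX [z z1]; split.
- suff -> : trace_to 0 = 0 by [].
  by apply: (addrI (trace_to 0)); rewrite -trace_toD !addr0.
- by move=> x y; rewrite trace_toD psiD.
- by move=> x; rewrite trace_toX psiX.
have [x x0] := trace_to_nontrivial.
by exists (iota (z / trace_to x) * x); rewrite trace_toZ mulfVK.
Qed.

End Extension.

(** * The Weil bound *)

Section Quadratic.
Variables (F L : finFieldType) (iota : {rmorphism F -> L}) (p h : nat).
Hypothesis pr_p : prime p.
Hypothesis cF : #|F| = (p ^ h)%N.
Hypothesis cL : #|L| = (#|F| ^ 2)%N.
Local Notation q := #|F|.
Local Notation tr := (trace_to F L iota 2).

Definition norm_to (z : L) : F := descend F L iota (z * z ^+ q).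

Lemma trace_to2E z : iota (tr z) = z + z ^+ q.
Proof. by rewrite (trace_toE F L iota p h 2) // /conj_trace !big_ord_recl big_ord0 addr0 expr1. Qed.

Lemma norm_toE z : iota (norm_to z) = z * z ^+ q.
Proof. by apply: descendK; rewrite exprMn -exprM mulnn -cL expf_card mulrC. Qed.

Lemma norm_to_eq0 z : (norm_to z == 0) = (z == 0).
Proof.
by rewrite -(fmorph_eq0 iota) norm_toE mulf_eq0 expf_eq0; case: (z == 0); rewrite ?andbF.
Qed.

Lemma trace_to_inv z : z != 0 -> tr z^-1 = tr z / norm_to z.
Proof.
move=> z0; have zq0 : z ^+ q != 0 by rewrite expf_neq0.
apply: (fmorph_inj iota); rewrite fmorph_div trace_to2E trace_to2E norm_toE exprVn.
by field; rewrite z0 zq0.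
Qed.

Definition pairs_over (T N : F) := [set w : F * F | (w.1 + w.2 == T) && (w.1 * w.2 == N)].
Definition points_over (T N : F) := [set z : L | (tr z == T) && (norm_to z == N)].

(** Pairs and points both consist of roots of [X^2 - T X + N]. Without a root in [F] there are no
    pairs. With roots [x], [y] in [F], a point is [x] or [y], and its trace then forces [x = y],
    leaving at most one pair and one point. *)
Lemma card_over_leq T N : (#|pairs_over T N| + #|points_over T N| <= 2)%N.
Proof.
have pts z : z \in points_over T N -> z ^+ 2 = iota T * z - iota N.
  by rewrite inE => /andP[/eqP <- /eqP <-]; rewrite trace_to2E norm_toE; ring.
have [/existsP[x /eqP Ex]|no_root] := boolP [exists x, x ^+ 2 == T * x - N]; last first.
  have -> : pairs_over T N = set0.
    apply/setP => -[x y]; rewrite !inE; apply: contraNF no_root => /= /andP[/eqP <- /eqP <-].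
    by apply/existsP; exists x; apply/eqP; ring.
  rewrite cards0; apply: leq_trans (card_quadratic L (iota T) (iota N)).
  by apply/subset_leq_card/subsetP => z /pts Ez; rewrite inE Ez.
pose y := T - x.
have ET : T = x + y by rewrite /y; ring.
have EN : N = x * y by rewrite /y mulrBr [x * T]mulrC -expr2 Ex; ring.
have pairsS : pairs_over T N \subset [set (x, y); (y, x)].
  apply/subsetP => -[x' y']; rewrite !inE /= ET EN => /andP[/eqP e1 /eqP e2].
  have: (x' - x) * (x' - y) == 0.
    apply/eqP; transitivity (x' ^+ 2 - (x + y) * x' + x * y); first by ring.
    by rewrite -e1 -e2; ring.
  rewrite mulf_eq0 !subr_eq0 => /orP[] /eqP h1; move: e1; rewrite h1.
    by move/addrI ->; rewrite eqxx.
  by rewrite [x + y]addrC => /addrI ->; rewrite eqxx orbT.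
have pointsS z : z \in points_over T N -> x = y /\ z = iota x.
  move=> zT; have Ez := pts z zT; move: zT; rewrite inE => /andP[/eqP Tz _].
  have : (z - iota x) * (z - iota y) == 0.
    apply/eqP; transitivity (z ^+ 2 - (iota x + iota y) * z + iota x * iota y); first by ring.
    by rewrite Ez ET EN rmorphD rmorphM; ring.
  have iq a : tr (iota a) = a + a.
    by apply: (fmorph_inj iota); rewrite trace_to2E rmorphD -rmorphXn expf_card.
  rewrite mulf_eq0 !subr_eq0 => /orP[] /eqP h1; move: Tz; rewrite h1 iq ET.
    by move/addrI.
  by move/addIr => ->.
have [xy|xy] := eqVneq x y.
  rewrite -xy setUid in pairsS.
  apply: (@leq_trans (1 + 1)) => //; apply: leq_add.
    by rewrite -(cards1 (x, x)); apply: subset_leq_card.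
  rewrite -(cards1 (iota x)); apply/subset_leq_card/subsetP => z /pointsS[_ ->].
  by rewrite inE.
have -> : points_over T N = set0.
  by apply/setP => z; rewrite [RHS]inE; apply: contra_neqF xy => /pointsS[].
rewrite cards0 addn0; apply: leq_trans (subset_leq_card pairsS) _.
by rewrite cards2; case: (_ != _).
Qed.

(* Equality holds on average, hence everywhere; this spares the discussion of which quadratics split in L. *)
Lemma card_over T N : (#|pairs_over T N| + #|points_over T N| = 2)%N.
Proof.
have cnt (U : finType) (f : U -> F * F) :
    (\sum_(w : F * F) #|[set a | f a == w]| = #|U|)%N.
  rewrite -sum1_card (partition_big f predT) //=; apply: eq_bigr => w _.
  by rewrite -sum1_card; apply: eq_bigl => a; rewrite inE.
have le w : (#|pairs_over w.1 w.2| + #|points_over w.1 w.2| <= 2 ?=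
    iff (#|pairs_over w.1 w.2| + #|points_over w.1 w.2| == 2))%N.
  by split => //; exact: card_over_leq.
have := @leqif_sum _ predT _ _ _ (fun w _ => le w).
case=> _; rewrite big_split /=.
rewrite (eq_bigr (fun w => #|[set a : F * F | (a.1 + a.2, a.1 * a.2) == w]|)); last first.
  by case=> a b _; congr #|pred_of_set _|; apply/setP => z; rewrite !inE xpair_eqE.
rewrite [X in (_ + X)%N](eq_bigr (fun w => #|[set a : L | (tr a, norm_to a) == w]|)); last first.
  by case=> a b _; congr #|pred_of_set _|; apply/setP => z; rewrite !inE xpair_eqE.
rewrite !cnt card_prod sum_nat_const card_prod cL -mulnn addnn -muln2 eqxx.
by move/esym/forall_inP/(_ (T, N) isT)/eqP.
Qed.

(** Terms are grouped by trace and norm, and [card_over] puts two of them over each [(T, N)]. This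
    links products of sums over [F] with sums over [L]. *)
Lemma sum_pairs_points (g : F -> F -> algC) :
  \sum_(w : F * F) g (w.1 + w.2) (w.1 * w.2) + \sum_z g (tr z) (norm_to z)
  = 2 * \sum_(w : F * F) g w.1 w.2.
Proof.
rewrite (partition_big (fun w => (w.1 + w.2, w.1 * w.2)) predT) //=.
rewrite [X in _ + X](partition_big (fun z => (tr z, norm_to z)) predT) //=.
rewrite -big_split mulr_sumr; apply: eq_bigr => -[T N] _ /=.
rewrite (eq_bigr (fun _ => g T N)); last by move=> w /eqP[-> ->].
rewrite [X in _ + X](eq_bigr (fun _ => g T N)); last by move=> w /eqP[-> ->].
rewrite !sumr_const -mulrnDr -[in RHS](card_over T N) mulr_natl; congr (_ *+ (_ + _)%N).
  by apply: eq_card => w; rewrite [RHS]inE -xpair_eqE.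
by apply: eq_card => w; rewrite [RHS]inE -xpair_eqE.
Qed.

(** Both [x + u/x + y + u/y] and the trace of [z + u/z] have the form [T (1 + u/N)], with [T], [N]
    the sum and product, respectively the trace and norm. Summed over all [T], the character
    vanishes unless [N = - u], which contributes [q]. *)
Lemma kloosterman_quadratic (psi : F -> algC) (u : F) :
  artin_character F p psi -> u != 0 ->
  kloosterman L (fun x => psi (tr x)) (iota u) = 2 * q%:R - kloosterman F psi u ^+ 2.
Proof.
move=> psiA u0; have [_ psiD _ _] := psiA.
pose g (T N : F) := if N == 0 then 0 else psi (T * (1 + u / N)).
suff : kloosterman F psi u ^+ 2 + kloosterman L (fun x => psi (tr x)) (iota u) = 2 * q%:R.
  by move=> <-; rewrite addrAC subrr add0r.
have -> : 2 * q%:R = 2 * \sum_(w : F * F) g w.1 w.2.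
  congr (_ * _); rewrite -(pair_big predT predT (fun a b => g a b)) exchange_big /=.
  rewrite (bigD1 (- u)) //= [X in _ + X]big1 ?addr0 => [|N Nu].
    rewrite (eq_bigr (fun _ => 1)) ?sumr_const // => T _.
    by rewrite /g oppr_eq0 (negbTE u0) invrN mulrN divff // subrr mulr0; case: psiA.
  rewrite /g; case: eqVneq => [|N0]; first by rewrite big1.
  rewrite (char_sum_mul _ _ _ psiA) ifN //.
  apply: contra Nu => /eqP h1; rewrite -addr_eq0; apply/eqP.
  by transitivity (N * (1 + u / N)); [field | rewrite h1 mulr0].
rewrite -sum_pairs_points; congr (_ + _).
  rewrite /kloosterman expr2 mulr_suml (big_mkcond (fun x => x != 0)) /=.
  rewrite -(pair_big predT predT (fun a b => g (a + b) (a * b))) /=.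
  apply: eq_bigr => x _; case: eqVneq => [->|x0] /=.
    by rewrite big1 // => y _; rewrite /g mul0r eqxx.
  rewrite mulr_sumr big_mkcond /=; apply: eq_bigr => y _.
  rewrite /g mulf_eq0 (negbTE x0) /=; case: eqVneq => [//|y0] /=.
  by rewrite -psiD; congr psi; field; rewrite x0 y0.
rewrite /kloosterman big_mkcond /=; apply: eq_bigr => z _.
rewrite /g norm_to_eq0; case: eqVneq => [//|z0] /=; congr psi.
rewrite (trace_toD F L iota p h 2) // (trace_toZ F L iota p h 2) // trace_to_inv //.
by rewrite mulrDr mulr1; ring.
Qed.
End Quadratic.

Section Weil.
Variable p : nat.
Hypothesis pr_p : prime p.

Let bounded (c : algC) := forall (h : nat) (E : finFieldType) (psi : E -> algC) (u : E),
  #|E| = (p ^ h)%N -> artin_character E p psi -> u != 0 ->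
  kloosterman E psi u ^+ 2 <= c * #|E|%:R.

(** The quadratic extension of [E] has [r^2] elements with [r = #|E|], so [K^2 = 2 r - K'] is at
    most [(2 + D) r]. *)
Lemma kloosterman_descent (D : algC) : 0 <= D ->
  (forall (h : nat) (E : finFieldType) (psi : E -> algC) (u : E),
    #|E| = ((p ^ h) ^ 2)%N -> artin_character E p psi -> u != 0 ->
    `|kloosterman E psi u| <= D * (p ^ h)%:R) ->
  bounded (2 + D).
Proof.
move=> D0 H h E psi u cE psiA u0.
have [L [iota cL]] := finField_extension E p h 2 pr_p cE isT.
have := H h L _ (iota u) _ (lift_character E L iota p h 2 pr_p cE cL isT psi psiA) _.
rewrite cL cE fmorph_eq0 => /(_ erefl u0).
rewrite (kloosterman_quadratic E L iota p h) // -cE.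
have pE := card_finPcharP cE pr_p.
have Kr : kloosterman E psi u \is Creal.
  by apply/CrealP; apply: (kloosterman_real _ p) psiA _.
rewrite distrC => le; rewrite mulrDl -lerBlDl; apply: le_trans le.
by rewrite real_ler_norm // rpredB ?rpredX // rpredM ?realn.
Qed.

(** The start is the Stepanov bound with [D = 2 p + 3]. For the step, [4 + d <= (2 + d/4)^2] gives
    [|K'| <= (2 + d/4) r] over a field of [r^2] elements, and descent yields the constant
    [4 + d/4]. *)
Lemma kloosterman_amplify j : bounded (4 + (2 * p + 1)%:R / 4 ^+ j).
Proof.
elim: j => [|j IH].
  have -> : 4 + (2 * p + 1)%:R / 4 ^+ 0 = 2 + (2 * p + 3)%:R :> algC.
    by rewrite expr0 divr1 !natrD; ring.
  apply: kloosterman_descent => [|h E psi u cE psiA u0]; first exact: ler0n.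
  rewrite -natrM; apply: kloosterman_stepanov => //.
  by apply: (@card_finPcharP _ _ (h * 2)) => //; rewrite expnM.
set d := (2 * p + 1)%:R / 4 ^+ j in IH.
have d0 : 0 <= d by rewrite divr_ge0 ?ler0n // exprn_ge0 // ler0n.
have -> : 4 + (2 * p + 1)%:R / 4 ^+ j.+1 = 2 + (2 + d / 4).
  by rewrite exprS /d; field; rewrite expf_neq0 ?pnatr_eq0.
apply: kloosterman_descent => [|h E psi u cE psiA u0].
  by rewrite addr_ge0 ?ler0n // divr_ge0 ?ler0n.
have D0 : 0 <= 2 + d / 4 by rewrite addr_ge0 ?ler0n // divr_ge0 ?ler0n.
have pE : p \in [pchar E] by apply: (@card_finPcharP _ _ (h * 2)) => //; rewrite expnM.
have Kr : kloosterman E psi u \is Creal.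
  by apply/CrealP; apply: (kloosterman_real _ p) psiA _.
have := IH (h * 2)%N E psi u; rewrite expnM => /(_ cE psiA u0) le.
rewrite -(@ler_pXn2r _ 2) ?nnegrE ?normr_ge0 ?mulr_ge0 ?ler0n // real_normK //.
apply: (le_trans le); rewrite cE natrX exprMn ler_wpM2r ?exprn_ge0 ?ler0n //.
have -> : (2 + d / 4) ^+ 2 = 4 + d + (d / 4) ^+ 2 by field.
by rewrite lerDl exprn_ge0 // divr_ge0 ?ler0n.
Qed.

(** Letting [j] grow: an excess [d = K^2 - 4 q > 0] would satisfy [d 4^j <= (2 p + 1) q] for all
    [j], against the Archimedean property. *)
Theorem kloosterman_weil : bounded 4.
Proof.
move=> h E psi u cE psiA u0.
have pE := card_finPcharP cE pr_p.
set K := kloosterman E psi u.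
have Kr : K ^+ 2 \is Creal.
  by rewrite rpredX //; apply/CrealP; apply: (kloosterman_real _ p) psiA _.
have q0 : 0 < #|E|%:R :> algC by rewrite ltr0n cE expn_gt0 prime_gt0.
rewrite real_leNgt // ?rpredM ?realn //; apply/negP => gt.
pose d := K ^+ 2 - 4 * #|E|%:R.
have d0 : 0 < d by rewrite subr_gt0.
pose C : algC := (2 * p + 1)%:R * #|E|%:R.
have key j : d * 4 ^+ j <= C.
  have := kloosterman_amplify j h E psi u cE psiA u0; rewrite -/K mulrDl -lerBlDl -/d => le.
  have f0 : 0 < 4 ^+ j :> algC by rewrite exprn_gt0 ?ltr0n.
  by rewrite -ler_pdivlMr // (le_trans le) // /C mulrAC.
have C0 : 0 <= C / d by rewrite divr_ge0 ?mulr_ge0 ?ler0n // ltW.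
have := archi_boundP C0; set N := Num.bound _; rewrite ltr_pdivrMr // => lt.
suff : C < d * 4 ^+ N by move/lt_le_trans/(_ (key N)); rewrite ltxx.
apply: lt_le_trans lt _.
by rewrite mulrC ler_pM2l // -natrX ler_nat ltnW // ltn_expl.
Qed.
End Weil.

(** * Elements with prescribed traces *)

Lemma prime_field_character (p : nat) : prime p -> exists psi, artin_character 'F_p p psi.
Proof.
move=> pr_p; have [z prim_z] := C_prim_root_exists (prime_gt0 pr_p).
have prim_z' : (Zp_trunc (pdiv p)).+2.-primitive_root z by rewrite Fp_cast.
exists (fun x : 'F_p => z ^+ x); split => //.
- by move=> x y; rewrite -exprD -[RHS](prim_expr_mod prim_z').
- by move=> x; rewrite -[p in x ^+ p](card_Fp pr_p) expf_card.
exists 1; rewrite expr1; apply/eqP => z1; have := prim_order_dvd prim_z 1.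
by rewrite z1 expr1n eqxx dvdn1 gtn_eqF ?prime_gt1.
Qed.

Lemma exists_artin_character (p h : nat) (F : finFieldType) :
  prime p -> #|F| = (p ^ h)%N -> exists psi, artin_character F p psi.
Proof.
move=> pr_p cF; have pF := card_finPcharP cF pr_p.
have [psi psiA] := prime_field_character p pr_p.
pose iota : {rmorphism 'F_p -> F} := [the {rmorphism 'F_p -> pPrimeCharType pF} of in_alg _].
have h_gt0 : (0 < h)%N by case: h cF (finNzRing_gt1 F) => // ->; rewrite expn0.
have c1 : #|'F_p| = (p ^ 1)%N by rewrite card_Fp ?expn1.
have ch : #|F| = (#|'F_p| ^ h)%N by rewrite c1 expn1.
eexists; exact: (lift_character 'F_p F iota p 1 h pr_p c1 ch h_gt0 psi psiA).
Qed.

Section Count.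
Variables (F L : finFieldType) (iota : {rmorphism F -> L}) (p h n : nat).
Hypothesis pr_p : prime p.
Hypothesis cF : #|F| = (p ^ h)%N.
Hypothesis cL : #|L| = (#|F| ^ n)%N.
Hypothesis n_ge5 : (5 <= n)%N.
Local Notation q := #|F|.
Local Notation tr := (trace_to F L iota n).

Let n_gt0 : (0 < n)%N. Proof. exact: leq_trans n_ge5. Qed.

Lemma exists_prescribed_traces (A B : F) :
  exists x : L, [/\ x != 0, tr x = A & tr x^-1 = B].
Proof.
have [psi psiA] := exists_artin_character p h F pr_p cF.
have [psi0 psiD _ _] := psiA.
pose psiL x := psi (tr x).
have psiLA : artin_character L p psiL := lift_character F L iota p h n pr_p cF cL n_gt0 psi psiA.
have pF := card_finPcharP cF pr_p.
pose S s t := \sum_(x | x != 0) psiL (iota s * x + iota t / x).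
(* By orthogonality [M] is [q^2] times the number of solutions, hence 0 if there is none. *)
pose M := \sum_(s : F) \sum_(t : F) psi (- (s * A + t * B)) * S s t.
have [/existsP[x /and3P[x0 /eqP hA /eqP hB]]|none] :=
  boolP [exists x : L, [&& x != 0, tr x == A & tr x^-1 == B]]; first by exists x.
have M0 : M = 0.
  rewrite /M; transitivity (\sum_(x : L | x != 0) (\sum_s psi (s * (tr x - A))) * \sum_t psi (t * (tr x^-1 - B))).
    under eq_bigr do under eq_bigr do rewrite mulr_sumr.
    under eq_bigr do rewrite exchange_big.
    rewrite exchange_big; apply: eq_bigr => x _ /=.
    rewrite mulr_suml; apply: eq_bigr => s _; rewrite mulr_sumr; apply: eq_bigr => t _.
    rewrite /psiL (trace_toD F L iota p h n) // !(trace_toZ F L iota p h n) // -!psiD.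
    by congr psi; ring.
  rewrite big1 // => x x0; rewrite !(char_sum_mul F p psi psiA) !subr_eq0.
  case: eqVneq => [eA|]; last by rewrite mul0r.
  case: eqVneq => [eB|]; last by rewrite mulr0.
  by case/existsP: none; exists x; rewrite x0 eA eB !eqxx.
have qn0 : 0 <= (q ^ n)%:R :> algC by exact: ler0n.
pose X := 2 * sqrtC (q ^ n)%:R : algC.
have X2 : X ^+ 2 = (4 * q ^ n)%:R by rewrite exprMn sqrtCK natrM; ring.
have X0 : 0 <= X by rewrite mulr_ge0 ?ler0n // sqrtC_ge0.
have S00 : S 0 0 = (q ^ n).-1%:R.
  rewrite /S (eq_bigr (fun _ => 1)); last first.
    by move=> x _; rewrite rmorph0 !mul0r addr0; case: psiLA.
  by rewrite sumr_const -cL -(cardC1 (0 : L)).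
have S0t t : t != 0 -> S 0 t = -1.
  move=> t0; rewrite /S (reindex_inj invr_inj) /=.
  rewrite (eq_big (fun x => x != 0) (fun x => psiL (x * iota t))).
  - by rewrite (char_sum_neq0 _ p _ psiLA) fmorph_eq0 (negbTE t0) sub0r.
  - by move=> x; rewrite invr_eq0.
  by move=> x _; rewrite rmorph0 mul0r add0r invrK mulrC.
have Ss0 s : s != 0 -> S s 0 = -1.
  move=> s0; rewrite /S.
  rewrite (eq_bigr (fun x => psiL (x * iota s))).
    by rewrite (char_sum_neq0 _ p _ psiLA) fmorph_eq0 (negbTE s0) sub0r.
  by move=> x _; rewrite rmorph0 mul0r addr0 mulrC.
have Sst s t : s != 0 -> t != 0 -> `|S s t| <= X.
  move=> s0 t0; have is0 : iota s != 0 by rewrite fmorph_eq0.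
  (* Replacing [x] by [x / s] turns [s x + t / x] into [x + s t / x]. *)
  have -> : S s t = kloosterman L psiL (iota (s * t)).
    rewrite /S (reindex_inj (mulIf (invr_neq0 is0))) /=; apply: eq_big => x.
      by rewrite mulf_eq0 invr_eq0 (negbTE is0) orbF.
    move=> x0; congr psiL; rewrite rmorphM; field; rewrite is0 /=.
    by rewrite andbT; apply: contraNneq x0 => ->; rewrite mul0r.
  have u0 : iota (s * t) != 0 by rewrite fmorph_eq0 mulf_neq0.
  have cL' : #|L| = (p ^ (h * n))%N by rewrite cL cF expnM.
  have Kr : kloosterman L psiL (iota (s * t)) \is Creal.
    by apply/CrealP; apply: (kloosterman_real L p) psiLA _; apply: card_finPcharP cL' pr_p.
  rewrite -(@ler_pXn2r _ 2) ?nnegrE ?normr_ge0 // real_normK // X2 natrM -cL.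
  exact: (kloosterman_weil p pr_p (h * n) L psiL _ cL' psiLA u0).
have norm1 := char_norm F p psi pF psiA.
pose f s t := psi (- (s * A + t * B)) * S s t.
have f00 : f 0 0 = (q ^ n).-1%:R by rewrite /f !mul0r addr0 oppr0 psi0 mul1r S00.
have f0t t : t != 0 -> `|f 0 t| <= 1 by move=> t0; rewrite normrM norm1 mul1r S0t // normrN1.
have fs0 s : s != 0 -> `|f s 0| <= 1 by move=> s0; rewrite normrM norm1 mul1r Ss0 // normrN1.
have fst s t : s != 0 -> t != 0 -> `|f s t| <= X by move=> s0 t0; rewrite normrM norm1 mul1r Sst.
pose q1 : algC := q.-1%:R.
have sum_le (g : F -> algC) (c : algC) : (forall s, s != 0 -> `|g s| <= c) -> `|\sum_(s | s != 0) g s| <= c * q1.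
  move=> gc; apply: (le_trans (ler_norm_sum _ _ _)); apply: (le_trans (ler_sum _ gc)).
  by rewrite sumr_const /q1 -(cardC1 (0 : F)) mulr_natr.
have : `|M - f 0 0| <= q1 + (1 + X * q1) * q1.
  have -> : M - f 0 0 = \sum_(t | t != 0) f 0 t + \sum_(s | s != 0) \sum_t f s t.
    by rewrite /M (bigD1 0) //= (bigD1 (0 : F)) //= /f; ring.
  apply: (le_trans (ler_normD _ _)); apply: lerD.
    by rewrite -[q1]mul1r; apply: (sum_le).
  apply: (sum_le) => s s0; rewrite (bigD1 0) //=; apply: (le_trans (ler_normD _ _)); apply: lerD.
    exact: fs0.
  by apply: (sum_le) => t t0; apply: (fst).
rewrite M0 sub0r normrN f00 normr_nat => le.
have q_gt1 : (1 < q)%N := finNzRing_gt1 F.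
have qn : (q ^ 5 <= q ^ n)%N by rewrite leq_exp2l.
have q5 : (4 * q.-1 ^ 4 + 4 * q < q ^ 5 + 2)%N.
  have [m ->] : exists m, q = m.+2 by exists q.-2; lia.
  by rewrite /= !expnS !expn0 !muln1; nia.
have lin : ((q ^ n + 1 - 2 * q)%N%:R : algC) <= X * q1 ^+ 2.
  have -> : (q ^ n + 1 - 2 * q)%N%:R = (q ^ n).-1%:R - (2 * q1) :> algC.
    rewrite /q1 -natrM -natrB; first by congr (_ %:R); lia.
    by lia.
  by rewrite lerBlDr (le_trans le) // le_eqVlt; apply/orP; left; apply/eqP; ring.
have : ((q ^ n + 1 - 2 * q)%N%:R : algC) ^+ 2 <= (X * q1 ^+ 2) ^+ 2.
  by rewrite ler_pXn2r // nnegrE ?ler0n // mulr_ge0 // exprn_ge0 // ler0n.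
rewrite exprMn X2 /q1 -!natrX -natrM ler_nat -expnM /= => sq.
(* With [c = 2 q - 1] and [v = (q - 1)^4], the squared bound reads [Y^2 <= 4 v (Y + c)]. But
   [Y >= 4 v + c], from [q5], gives [Y^2 >= 4 v Y + c (4 v + c)], which is larger as [c > 0]. *)
have [Y cY [YE ZE]] : exists2 Y, (4 * q.-1 ^ 4 + (2 * q - 1) <= Y)%N &
    (q ^ n + 1 - 2 * q = Y)%N /\ (q ^ n = Y + (2 * q - 1))%N.
  by exists (q ^ n + 1 - 2 * q)%N; [|split]; lia.
move: sq; rewrite YE ZE; have [d ->] : exists d, Y = (4 * q.-1 ^ 4 + (2 * q - 1) + d)%N.
  by exists (Y - (4 * q.-1 ^ 4 + (2 * q - 1)))%N; lia.
have : (0 < 2 * q - 1)%N by lia.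
move: (2 * q - 1)%N (q.-1 ^ 4)%N => c v c0.
rewrite -mulnn => sq; exfalso; nia.
Qed.
End Count.

(** * Irreducible polynomials *)

(** This turns the condition on [c_(n-1) / c_n] into one on the sum of the inverse roots, that is,
    on the trace of [1/x]. *)
Lemma coef1_prod_XsubC (K : fieldType) (s : seq K) : 0 \notin s ->
  (\prod_(c <- s) ('X - c%:P))`_1 =
  - (\sum_(c <- s) c^-1) * (\prod_(c <- s) ('X - c%:P))`_0.
Proof.
elim: s => [|c s IH]; first by rewrite !big_nil coefC oppr0 mul0r.
rewrite inE negb_or eq_sym => /andP[c0 /IH Es].
rewrite !big_cons mulrBl !coefB coefXM /= mul_polyC !coefZ Es coefXM /=.
by field.
Qed.

Section Conjugates.
Variables (F L : finFieldType) (emb : {rmorphism F -> L}) (p h n : nat).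
Hypothesis cF : #|F| = (p ^ h)%N.
Hypothesis cL : #|L| = (#|F| ^ n)%N.
Hypothesis pr_n : prime n.
Hypothesis pr_p : prime p.
Local Notation q := #|F|.
Variable x : L.
Hypothesis x_notin : x ^+ q != x.

Let c (i : nat) := x ^+ (q ^ i).
Let cn : c n = x. Proof. by rewrite /c -cL expf_card. Qed.
Let n_gt0 : (0 < n)%N. Proof. exact: prime_gt0. Qed.

Let iter_fix d k : c d = x -> c (k * d) = x.
Proof. by move=> cd; elim: k => [|k IH]; rewrite /c ?expr1 // mulSn expnD exprM -/(c d) cd. Qed.

(** As [n] is prime, Bezout gives [u d = v n + 1]. If the [d]-th Frobenius power fixed [x], as the
    [n]-th does, then so would the Frobenius itself. *)
Lemma conj_neq d : (0 < d < n)%N -> c d != x.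
Proof.
move=> /andP[d0 dn]; apply: contraNneq x_notin => cd; apply/eqP.
case: (egcdnP n d0) => u v Euv _.
have cop : coprime d n by rewrite coprime_sym prime_coprime // gtnNdvd.
move: Euv; rewrite (eqP cop) => Euv.
rewrite -[RHS](iter_fix d u cd) Euv /c expnD exprM -/(c (v * n)) iter_fix ?cn //.
Qed.

Lemma uniq_conj : uniq [seq c i | i <- seq.iota 0 n].
Proof.
have H i j : (i < j)%N -> (j < n)%N -> c i != c j.
  move=> ij jn; apply: contraTneq (conj_neq (j - i) _); last by lia.
  move=> Ec; rewrite negbK; apply/eqP.
  (* Applying [n - i] more Frobenius steps moves [c i] to [x] and [c j] to [c (j - i)]. *)
  have := congr1 (fun y => y ^+ (q ^ (n - i))) Ec; rewrite -!exprM -!expnD.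
  rewrite subnKC; last by lia.
  rewrite -/(c n) cn (_ : j + (n - i) = n + (j - i))%N; last by lia.
  by rewrite expnD exprM -/(c n) cn => Ex; rewrite /c -Ex.
rewrite map_inj_in_uniq ?iota_uniq // => i j; rewrite !mem_iota /= => ni nj /eqP Ec.
by case: (ltngtP i j) => // ij; move: Ec; rewrite ?(negbTE (H _ _ ij _)) // eq_sym (negbTE (H _ _ ij _)).
Qed.

Lemma conj_root (f : {poly F}) : root (map_poly emb f) x ->
  forall i, root (map_poly emb f) (c i).
Proof.
move=> fx i; rewrite /root !horner_coef in fx *; apply/eqP.
transitivity ((\sum_(k < size (map_poly emb f)) (map_poly emb f)`_k * x ^+ k) ^+ (q ^ i)).
  rewrite (frobenius_sum F L emb p h) //; apply: eq_bigr => k _.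
  by rewrite exprMn coef_map iota_frobenius /c -!exprM mulnC.
by rewrite (eqP fx) expr0n expn_eq0 (gtn_eqF (ltnW (finNzRing_gt1 F))).
Qed.

Lemma conj_root_size (f : {poly F}) : f != 0 -> root (map_poly emb f) x -> (n < size f)%N.
Proof.
move=> f0 fx; have f0' : map_poly emb f != 0 by rewrite map_poly_eq0.
have := max_poly_roots f0' _ uniq_conj; rewrite size_map size_iota size_map_poly; apply.
by apply/allP => _ /mapP[i _ ->]; exact: conj_root.
Qed.

(** Pigeonhole: the [q^(n+1)] polynomials of size at most [n + 1] take only [q^n] values at [x], so
    two of them agree there. *)
Lemma exists_annihilator : exists2 f : {poly F}, f != 0 & (size f <= n.+1)%N /\ root (map_poly emb f) x.
Proof.
pose ev (v : 'rV[F]_n.+1) := (map_poly emb (rVpoly v)).[x].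
have /injectivePn[v [v' vv' Ev]] : ~~ injectiveb ev.
  apply/negP => /injectiveP /leq_card; rewrite card_mx mul1n cL leq_exp2l ?finNzRing_gt1 //.
  by rewrite ltnn.
exists (rVpoly (v - v')); last split; last 2 first.
- exact: size_poly.
- by rewrite /root raddfB /= rmorphB /= hornerD hornerN -/(ev v) -/(ev v') Ev subrr.
apply: contraNneq vv' => E0; rewrite -subr_eq0; apply/eqP.
by rewrite -(rVpolyK (v - v')) E0 linear0.
Qed.

(** The annihilator made monic has size exactly [n + 1] by [conj_root_size], so the [n] distinct
    conjugates are all its roots. In a factorisation [x] is a root of one factor, which then already
    has full degree. *)
Lemma exists_minpoly : exists f : {poly F},
  [/\ f \is monic, irreducible_poly f & map_poly emb f = \prod_(i < n) ('X - (c i)%:P)].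
Proof.
have [g g0 [sg gx]] := exists_annihilator.
have lg : lead_coef g != 0 by rewrite lead_coef_eq0.
pose f := (lead_coef g)^-1 *: g.
have fM : f \is monic by rewrite monicE lead_coefZ mulVf.
have f0 := monic_neq0 fM.
have fx : root (map_poly emb f) x by rewrite map_polyZ rootZ // fmorph_eq0 invr_eq0.
have sf : size f = n.+1.
  by apply/eqP; rewrite eqn_leq conj_root_size // andbT size_scale ?invr_eq0.
have Ef : map_poly emb f = \prod_(i < n) ('X - (c i)%:P).
  have Es : size (map_poly emb f) = (size [seq c i | i <- seq.iota 0 n]).+1.
    by rewrite size_map_poly sf size_map size_iota.
  have rs : all (root (map_poly emb f)) [seq c i | i <- seq.iota 0 n].
    by apply/allP => _ /mapP[i _ ->]; exact: conj_root.
  rewrite [LHS](all_roots_prod_XsubC Es rs) ?uniq_rootsE ?uniq_conj //.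
  rewrite lead_coef_map (monicP fM) rmorph1 scale1r big_map -(big_mkord predT (fun i => 'X - (c i)%:P)).
  by rewrite /index_iota subn0.
suff irr (d : {poly F}) : size d <> 1%N -> d %| f -> d %= f.
  by exists f; split => //; split=> [|d /eqP d1 df]; [rewrite sf ltnS | exact: irr].
move=> d1 df.
have [e Ee] : exists e : {poly F}, f = e * d by apply/dvdpP.
have [e0 d0] : e != 0 /\ d != 0 by apply/andP; rewrite -negb_or -mulf_eq0 -Ee.
have sde : (size e + size d = n.+2)%N.
  have : n.+1 = (size e + size d).-1 by rewrite -sf Ee size_mul.
  by clear; lia.
have : root (map_poly emb e) x || root (map_poly emb d) x.
  by rewrite -rootM -rmorphM -Ee.
case/orP => /conj_root_size H.
  have := H e0; have : (0 < size d)%N by rewrite size_poly_gt0.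
  by move: sde d1; clear=> *; exfalso; lia.
have e1 : (0 < size e)%N by rewrite size_poly_gt0.
have sd : size d = n.+1 by move: (H d0) sde e1; clear; lia.
by rewrite -dvdp_size_eqp // sf sd.
Qed.
End Conjugates.

Theorem theorem6p18 (p h : nat) (F : finFieldType) (a b : F) (n : nat) :
  prime p ->
  #|F| = (p ^ h)%N ->
  prime n -> n <> 2%N -> n <> 3%N ->
  (n ^ 2)%N%:R <> a * b ->
  exists f : {poly F},
    [/\ f \is monic, irreducible_poly f, size f = n.+1, f`_(n.-1) = a
      & f`_1 / f`_0 = b].
Proof.
move=> pr_p cF pr_n n2 n3 nab.
have n5 : (4 < n)%N.
  have := prime_gt1 pr_n; have : n != 4 by apply: contraTneq pr_n => ->.
  by move=> /eqP; lia.
have n0 : (0 < n)%N by lia.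
have [L [emb cL]] := finField_extension F p h n pr_p cF n0.
(* The signs come from Vieta: the coefficient of [X^(n-1)] and the quotient of the last two
   coefficients are minus the traces of [x] and [1/x]. *)
have [x [x0 trx trxV]] := exists_prescribed_traces F L emb p h n pr_p cF cL n5 (- a) (- b).
have x_notin : x ^+ #|F| != x.
  apply/negP => /eqP xq; apply: nab.
  have [y Ey] : exists y, emb y = x by exists (descend F L emb x); apply: descendK.
  have y0 : y != 0 by rewrite -(fmorph_eq0 emb) Ey.
  have tr_emb z : trace_to F L emb n (emb z) = n%:R * z.
    apply: (fmorph_inj emb); rewrite (trace_toE F L emb p h) // rmorphM rmorph_nat.
    rewrite /conj_trace; under eq_bigr do rewrite iota_frobenius.
    by rewrite sumr_const card_ord mulr_natl.
  rewrite -[a]opprK -[b]opprK -trx -trxV -Ey -fmorphV !tr_emb mulrNN natrX.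
  by field.
have [f [fM fI Ef]] := exists_minpoly F L emb p h n cF cL pr_n pr_p x x_notin.
pose s := [seq x ^+ (#|F| ^ i) | i <- seq.iota 0 n].
have Es (R : Type) (idx : R) (op : Monoid.law idx) (G : L -> R) :
    \big[op/idx]_(i < n) G (x ^+ (#|F| ^ i)) = \big[op/idx]_(y <- s) G y.
  by rewrite big_map -(big_mkord predT (fun i => G (x ^+ (#|F| ^ i)))) /index_iota subn0.
have ss : size s = n by rewrite size_map size_iota.
have s0 : 0 \notin s.
  by apply/mapP => -[i _ /esym/eqP]; rewrite expf_eq0 (negbTE x0) andbF.
rewrite (Es _ _ _ (fun y => 'X - y%:P)) in Ef.
have coefE i : emb f`_i = (\prod_(y <- s) ('X - y%:P))`_i by rewrite -Ef coef_map.
exists f; split => //.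
- by rewrite -(size_map_poly emb) Ef size_prod_XsubC ss.
- apply: (fmorph_inj emb); rewrite coefE -ss coefPn_prod_XsubC ?ss -?lt0n //.
  rewrite -[a]opprK -trx rmorphN (trace_toE F L emb p h) //; congr (- _).
  by rewrite -(Es _ _ _ id).
have f00 : emb f`_0 != 0.
  rewrite coefE -horner_coef0 -/(root _ 0) root_prod_XsubC //.
apply: (fmorph_inj emb); rewrite fmorph_div !coefE coef1_prod_XsubC // -coefE mulfK //.
rewrite -[b]opprK -trxV rmorphN (trace_toE F L emb p h) //; congr (- _).
rewrite -(Es _ _ _ (fun y => y^-1)); apply: eq_bigr => i _.
by rewrite exprVn.
Qed.
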